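(* Let $x$ be an $N$-periodic trajectory of a convex billiard, nondegenerate with respect to periodic variations. Then, up to scaling, there is a unique nonzero periodic Jacobi variation $\delta x_\Delta$, i.e. a unique up to scaling nonzero $\delta x_\Delta\in T_x\mathcal C^N_\Delta$ with $H_x\,\delta x_\Delta=(c^1,0,\dots,0,c^2)^T$ for some $c^1,c^2\in\mathbb R$. The concavity of $x$ is given by $$C_\Delta(x)=\begin{cases}1,&\text{if }H_x(\delta x_\Delta,\delta x_\Delta)\le 0,\\ 0,&\text{if }H_x(\delta x_\Delta,\delta x_\Delta)>0.\end{cases}$$
   Context: Billiard setting. $\gamma:S^1\to\mathbb R^2$ is a positively oriented, unit-speed parametrized simple closed $C^2$ curve, the boundary of the billiard table (convex billiard: the table is convex). Put $\ell(u,v)=|\gamma(u)-\gamma(v)|$ and $S=-\ell$. For $N\ge 2$, $\mathcal C^N\subset(S^1)^{N+1}$ is the open set of admissible paths $x=(x^1,\dots,x^{N+1})$: for every $i=1,\dots,N$ one has $x^i\ne x^{i+1}$, and the line segment from $\gamma(x^i)$ to $\gamma(x^{i+1})$ is contained in the table and is never tangent to $\gamma$. Let $L(x)=\sum_{i=1}^N S(x^i,x^{i+1})$. An $N$-periodic trajectory is an $x\in\mathcal C^N$ with $x^1=x^{N+1}$, $\partial_1S(x^i,x^{i+1})+\partial_2S(x^{i-1},x^i)=0$ for $i=2,\dots,N$, and $\partial_1S(x^1,x^2)+\partial_2S(x^N,x^{N+1})=0$ (a critical point of $L$ on $\{x\in\mathcal C^N: x^1=x^{N+1}\}$). Index. Identify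 $T_x\mathcal C^N$ with $\mathbb R^{N+1}$ (entries $\delta x^i$) and let $H_x$ be the symmetric bilinear form with matrix $\big(\partial^2L/\partial x^i\partial x^j(x)\big)$, where $L$ is regarded as a function of all $N+1$ variables. Let $T_x\mathcal C^N_0=\{\delta x^1=\delta x^{N+1}=0\}$ (fixed-endpoint variations) and $T_x\mathcal C^N_\Delta=\{\delta x^1=\delta x^{N+1}\}$ (periodic variations). The index of a symmetric form is the maximal dimension of a subspace on which it is negative definite. $i_0(x)$, $i_\Delta(x)$ are the indices of $H_x$ restricted to $T_x\mathcal C^N_0$, $T_x\mathcal C^N_\Delta$ respectively; $x$ is nondegenerate with respect to periodic variations if $H_x|_{T_x\mathcal C^N_\Delta}$ has trivial nullspace. A Jacobi variation is a $\delta x$ with $(H_x\delta x)^i=0$ for $i=2,\dots,N$. For $x$ nondegenerate with respect to periodic variations, the concavity $C_\Delta(x)$ is defined by $i_\Delta(x)=i_0(x)+C_\Delta(x)$. *)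

(* Defs.v *)
From mathcomp Require Import all_boot all_order all_algebra.
From mathcomp Require Import all_classical all_reals all_analysis.
Import Order.TTheory GRing.Theory Num.Theory.
Import numFieldNormedType.Exports.

Set Implicit Arguments.
Unset Strict Implicit.
Unset Printing Implicit Defensive.

Local Open Scope classical_set_scope.
Local Open Scope ring_scope.

Section Plane.
Variable R : realType.
Implicit Types p q : 'cV[R]_2.

(* The canonical norm `|p| on matrices is the sup norm. *)
Definition enorm p : R := Num.sqrt (p 0 0 ^+ 2 + p 1 0 ^+ 2).

Definition cross p q : R := p 0 0 * q 1 0 - p 1 0 * q 0 0.

(* Rotation by +pi/2. *)
Definition rot p : 'cV[R]_2 := \col_i (if i == 0 then - p 1 0 else p 0 0).

Definition segment p q : set 'cV[R]_2 :=
  [set p + s *: (q - p) | s in [set s : R | 0 <= s <= 1]].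

End Plane.

(* The circle S^1 is R / T Z, where T is the length of the curve.  A map on S^1
   is a T-periodic map on R, a point of S^1 is given by any of its lifts to R,
   and circle_eq is equality of the points of S^1 represented by two lifts. *)
Section Curve.
Variables (R : realType) (T : R) (gamma : R -> 'cV[R]_2).

Definition circle_eq (u v : R) : Prop := exists k : int, v = u + k%:~R * T.

(* The curve together with the bounded components of its complement. *)
Definition table : set 'cV[R]_2 :=
  range gamma `|`
  [set p | ~ range gamma p /\
           bounded_set (connected_component (~` range gamma) p)].

(* The interior of the table lies to the left of the direction of travel. *)
Definition positively_oriented : Prop :=
  forall t : R, \forall e \near 0^'+,
    table° (gamma t + e *: rot (derive1 gamma t)).

Record billiard_curve : Prop := BilliardCurve {
  period_gt0 : 0 < T ;
  (* gamma is T-periodic, and injective on S^1 *)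
  simple_closed : forall u v, gamma u = gamma v <-> circle_eq u v ;
  derivable_curve : forall t, derivable gamma t 1 ;
  derivable_curve' : forall t, derivable (derive1 gamma) t 1 ;
  continuous_curve'' : continuous (derive1 (derive1 gamma)) ;
  unit_speed : forall t, enorm (derive1 gamma t) = 1 ;
  orientation : positively_oriented }.

Definition convex_billiard : Prop :=
  billiard_curve /\ @convex_set R 'cV[R]_2 table.

Definition len (u v : R) : R := enorm (gamma u - gamma v).

(* The generating function S = - l. *)
Definition gen (u v : R) : R := - len u v.

Definition d1S (u v : R) : R := derive1 (fun w => gen w v) u.

Definition d2S (u v : R) : R := derive1 (gen u) v.

(* The entry x^(i+1), i = 0, ..., N, of a path is x (inord i) 0. *)
Section Paths.
Variable N : nat.
Implicit Types x : 'cV[R]_N.+1.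

Definition admissible x : Prop :=
  forall i, (i < N)%N ->
    let u := x (inord i) 0 in
    let v := x (inord i.+1) 0 in
    [/\ ~ circle_eq u v,
        segment (gamma u) (gamma v) `<=` table &
        forall t, segment (gamma u) (gamma v) (gamma t) ->
          cross (derive1 gamma t) (gamma v - gamma u) != 0].

Definition L x : R := \sum_(i < N) gen (x (inord i) 0) (x (inord i.+1) 0).

Definition periodic_trajectory x : Prop :=
  [/\ admissible x,
      circle_eq (x ord0 0) (x ord_max 0),
      forall i, (0 < i < N)%N ->
        d1S (x (inord i) 0) (x (inord i.+1) 0)
        + d2S (x (inord i.-1) 0) (x (inord i) 0) = 0 &
      d1S (x (inord 0) 0) (x (inord 1) 0)
      + d2S (x (inord N.-1) 0) (x (inord N) 0) = 0].

Definition hess x : 'M[R]_N.+1 :=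
  \matrix_(i, j) 'D_(delta_mx i 0) (fun y => 'D_(delta_mx j 0) L y) x.

End Paths.
End Curve.

Section Forms.
Variables (R : realType) (n : nat).
Implicit Types (H : 'M[R]_n) (V : set 'cV[R]_n).

Definition bform H (u v : 'cV[R]_n) : R := (u^T *m H *m v) 0 0.

Definition negative_definite_on H (W : {vspace 'cV[R]_n}) : Prop :=
  forall w, w \in W -> w != 0 -> bform H w w < 0.

Definition index H V : nat :=
  \max_(d < n.+1 | `[< exists W : {vspace 'cV[R]_n},
      [/\ [set` W] `<=` V, \dim W = d & negative_definite_on H W] >]) d.

Definition nondegenerate_on H V : Prop :=
  forall v, V v -> (forall w, V w -> bform H v w = 0) -> v = 0.

End Forms.

Section Variations.
Variables (R : realType) (N : nat).

Definition fixed_variations : set 'cV[R]_N.+1 :=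
  [set dx | dx ord0 0 = 0 /\ dx ord_max 0 = 0].

Definition periodic_variations : set 'cV[R]_N.+1 :=
  [set dx | dx ord0 0 = dx ord_max 0].

Definition jacobi_variation (H : 'M[R]_N.+1) (dx : 'cV[R]_N.+1) : Prop :=
  forall i, i != ord0 -> i != ord_max -> (H *m dx) i 0 = 0.

(* (c1, 0, ..., 0, c2)^T *)
Definition endpoint_col (c1 c2 : R) : 'cV[R]_N.+1 :=
  \col_i (if i == ord0 then c1 else if i == ord_max then c2 else 0).

Definition concavity (H : 'M[R]_N.+1) : int :=
  (index H periodic_variations)%:Z - (index H fixed_variations)%:Z.

End Variations.
Arguments fixed_variations {R N}.
Arguments periodic_variations {R N}.

(* Main.v *)
From HB Require Import structures.
Require Import Defs.
From mathcomp Require Import all_boot all_order all_algebra.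
From mathcomp Require Import all_classical all_reals all_analysis.
From mathcomp Require Import ring.
Import Order.TTheory GRing.Theory Num.Theory.
Import numFieldNormedType.Exports.
Local Open Scope classical_set_scope.
Local Open Scope ring_scope.

(* Only two facts about the billiard are needed: consecutive bounce points are
   distinct, so that L is twice differentiable near x, and the Hessian H is
   symmetric.  The rest is linear algebra.  A periodic Jacobi variation d is a
   vector of the periodic space V orthogonal to the fixed-endpoint hyperplane
   V0 of V; such d form a line because H is nondegenerate on V.
   - If H(d,d) > 0, shearing along d maps a negative definite subspace of V
     injectively to a negative definite subspace of V0.
   - If H(d,d) < 0, adding d to a negative definite subspace of V0 raises its
     dimension by one.
   - If H(d,d) = 0 then d lies in V0; some e in V has H(d,e) <> 0, and
     projecting e off a negative definite subspace W of V0, then adding a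
     multiple of d, yields a negative vector orthogonal to W. *)

(** * Directional derivatives of a Euclidean norm *)

Section Chord.
Variables (R : realType) (V : normedModType R).
Implicit Types (y v w : V).

(** Both difference quotients coincide, so one-variable rules such as the chain rule carry over to
    directional derivatives. *)
Lemma is_derive_line (f : V -> R) y v df :
  is_derive (0 : R) 1 (fun h : R => f (h *: v + y)) df <-> is_derive y v f df.
Proof.
have E : (fun h : R => h^-1 *: ((f \o shift y) (h *: v) - f y)) =
  (fun h : R => h^-1 *: (((fun h0 : R => f (h0 *: v + y)) \o shift 0) (h *: 1) -
     f (0 *: v + y))).
  by apply/funext => h; rewrite /= addr0 scale0r add0r [h *: 1]mulr1.
have d : derivable (fun h : R => f (h *: v + y)) 0 1 = derivable f y v.
  by rewrite /derivable -E.
have D : 'D_1 (fun h : R => f (h *: v + y)) 0 = 'D_v f y.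
  by rewrite /derive -E.
by split => -[]; [rewrite d D|rewrite -d -D].
Qed.

Lemma is_derive_comp (f : R -> R) (g : V -> R) y v a b :
  is_derive (g y) 1 f a -> is_derive y v g b ->
  is_derive y v (fun z => f (g z)) (a * b).
Proof.
move=> fa gb; apply/is_derive_line.
apply: (@is_derive1_comp _ f (fun h : R => g (h *: v + y))).
  by rewrite scale0r add0r.
exact/is_derive_line.
Qed.

Lemma is_derive_hypot (f g : V -> R) y v df dg :
  is_derive y v f df -> is_derive y v g dg -> 0 < f y ^+ 2 + g y ^+ 2 ->
  is_derive y v (fun z => Num.sqrt (f z ^+ 2 + g z ^+ 2))
    ((f y * df + g y * dg) / Num.sqrt (f y ^+ 2 + g y ^+ 2)).
Proof.
move=> fdf gdg h0.
have hs : is_derive y v (fun z => f z ^+ 2 + g z ^+ 2)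
    (f y * df *+ 2 + g y * dg *+ 2).
  have h := is_deriveD (is_deriveX 2 fdf) (is_deriveX 2 gdg).
  by apply: (is_derive_eq h); rewrite /= !expr1 /GRing.scale /=; ring.
apply: is_derive_eq; first by apply: is_derive_comp hs; exact: is_derive1_sqrt.
by rewrite /= /GRing.scale /=; field; rewrite gt_eqF ?sqrtr_gt0.
Qed.

(* Symmetry of the value under exchanging the directions behind df and df' is
   what makes the Hessian symmetric. *)
Lemma is_derive_hypot2 (f g df dg : V -> R) y w df' dg' ddf ddg :
  is_derive y w f df' -> is_derive y w g dg' ->
  is_derive y w df ddf -> is_derive y w dg ddg ->
  0 < f y ^+ 2 + g y ^+ 2 ->
  let r := Num.sqrt (f y ^+ 2 + g y ^+ 2) in
  is_derive y w
    (fun z => (f z * df z + g z * dg z) / Num.sqrt (f z ^+ 2 + g z ^+ 2))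
    ((df' * df y + dg' * dg y + f y * ddf + g y * ddg) / r
     - (f y * df y + g y * dg y) * (f y * df' + g y * dg') / r ^+ 3).
Proof.
move=> hf hg hdf hdg h0 r.
have r0 : 0 < r by rewrite sqrtr_gt0.
have hr := is_derive_hypot _ _ _ _ _ _ hf hg h0.
have hV : is_derive r 1 (fun t : R => t^-1) (- r ^- 2 *: 1).
  exact: (@is_deriveV _ id r 1 1 (lt0r_neq0 r0)).
have hrV := is_derive_comp _ _ _ _ _ _ hV hr.
have h := is_deriveM (is_deriveD (is_deriveM hf hdf) (is_deriveM hg hdg)) hrV.
apply: (is_derive_eq h); rewrite !fctE /= /GRing.scale /= -/r.
by field; rewrite gt_eqF.
Qed.

End Chord.

(** * Symmetry of the Hessian of the length functional *)

Section Hessian.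
Variables (R : realType) (gamma : R -> 'cV[R]_2) (N : nat).
Hypothesis gamma1 : forall t, derivable gamma t 1.
Hypothesis gamma2 : forall t, derivable (derive1 gamma) t 1.
Implicit Types (x y v w : 'cV[R]_N.+1) (p q : 'I_N.+1) (k : 'I_2).

Lemma is_derive_entry m n (f : R -> 'M[R]_(m, n)) t i j :
  derivable f t 1 -> is_derive t 1 (fun s => f s i j) (derive1 f t i j).
Proof.
move=> ft; split; first by move/derivable_mxP: (ft); exact.
by rewrite derive1E (derive_mx ft) mxE.
Qed.

Lemma is_derive_coord y v p : is_derive y v (fun z => z p 0) (v p 0).
Proof.
apply/is_derive_line.
have -> : (fun h : R => (h *: v + y) p 0) = (fun h : R => h * v p 0 + y p 0).
  by apply/funext => h; rewrite !mxE.
have h := is_deriveD (is_deriveM (is_derive_id (0 : R) 1)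
  (is_derive_cst (v p 0) (0 : R) 1)) (is_derive_cst (y p 0) (0 : R) 1).
apply: (is_derive_eq h); rewrite /cst /= /GRing.scale /=; ring.
Qed.

Definition chord p q y k : R := gamma (y p 0) k 0 - gamma (y q 0) k 0.

Definition dchord p q v y k : R :=
  v p 0 * derive1 gamma (y p 0) k 0
  - v q 0 * derive1 gamma (y q 0) k 0.

(** Derivative of the chord along [v], then along [w]. Each endpoint moves with one coordinate only,
    so no term mixes [p] and [q], and exchanging [v] and [w] changes nothing. *)
Definition ddchord p q v w y k : R :=
  v p 0 * (derive1 (derive1 gamma) (y p 0) k 0 * w p 0)
  - v q 0 * (derive1 (derive1 gamma) (y q 0) k 0 * w q 0).

Lemma is_derive_chord p q y v k :
  is_derive y v (fun z => chord p q z k) (dchord p q v y k).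
Proof.
have h r : is_derive y v (fun z => gamma (z r 0) k 0)
    (v r 0 * derive1 gamma (y r 0) k 0).
  have hk := is_derive_entry _ _ _ _ k 0 (gamma1 (y r 0)).
  rewrite mulrC.
  exact: (is_derive_comp _ _ _ _ _ _ _ _ hk (is_derive_coord y v r)).
exact: (is_deriveB (h p) (h q)).
Qed.

Lemma ddchordC p q v w y k : ddchord p q v w y k = ddchord p q w v y k.
Proof.
by congr (_ - _); rewrite [LHS]mulrC [LHS]mulrAC [LHS]mulrC.
Qed.

Lemma is_derive_dchord p q y v w k :
  is_derive y w (fun z => dchord p q v z k) (ddchord p q v w y k).
Proof.
have h r : is_derive y w (fun z => v r 0 * derive1 gamma (z r 0) k 0)
    (v r 0 * (derive1 (derive1 gamma) (y r 0) k 0 * w r 0)).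
  have h1 : is_derive y w (fun z => derive1 gamma (z r 0) k 0)
      (derive1 (derive1 gamma) (y r 0) k 0 * w r 0).
    have hk := is_derive_entry _ _ _ _ k 0 (gamma2 (y r 0)).
    exact: (is_derive_comp _ _ _ _ _ _ _ _ hk (is_derive_coord y w r)).
  exact: (is_deriveZ (v r 0) h1).
exact: (is_deriveB (h p) (h q)).
Qed.

Definition sqchord p q y : R := chord p q y 0 ^+ 2 + chord p q y 1 ^+ 2.

Lemma genE p q y : gen gamma (y p 0) (y q 0) = - Num.sqrt (sqchord p q y).
Proof. by rewrite /gen /len /enorm /sqchord /chord !mxE. Qed.

Lemma sqchord_gt0 p q y : gamma (y p 0) <> gamma (y q 0) -> 0 < sqchord p q y.
Proof.
move=> pq; rewrite lt_def addr_ge0 ?sqr_ge0// andbT paddr_eq0 ?sqr_ge0//.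
rewrite !sqrf_eq0 !subr_eq0; apply/negP => /andP[/eqP e0 /eqP e1]; apply: pq.
apply/matrixP => i j; rewrite (ord1 j).
have : i = 0 \/ i = 1; last by case=> ->.
by case: i => -[|[|//]] ?; [left|right]; exact/val_inj.
Qed.

Lemma sqchord_continuous p q : continuous (sqchord p q).
Proof.
have c k r : continuous (fun y => gamma (y r 0) k 0).
  move=> y.
  apply: (@continuous_comp _ _ _ (fun y => y r 0) (fun t => gamma t k 0)).
    exact: coord_continuous.
  apply: differentiable_continuous; apply/derivable1_diffP.
  by have [] := is_derive_entry _ _ gamma (y r 0) k 0 (gamma1 _).
have d k : continuous (fun y => chord p q y k).
  by move=> y; exact: (cvgB (c k p y) (c k q y)).
by move=> y; exact: (cvgD (cvgM (d 0 y) (d 0 y)) (cvgM (d 1 y) (d 1 y))).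
Qed.

(** Closed form of the derivative of one summand of [L] along [v], valid where the chord is
    nonzero. *)
Definition dgen p q v y : R :=
  - ((chord p q y 0 * dchord p q v y 0 + chord p q y 1 * dchord p q v y 1)
     / Num.sqrt (sqchord p q y)).

Lemma is_derive_gen p q y v : 0 < sqchord p q y ->
  is_derive y v (fun z => gen gamma (z p 0) (z q 0)) (dgen p q v y).
Proof.
move=> pq; under eq_fun do rewrite genE.
apply: is_deriveN; apply: is_derive_hypot => //; exact: is_derive_chord.
Qed.

(** The explicit second derivative of the hypotenuse is symmetric in the two directions, term by
    term. *)
Lemma derive_dgenC p q y v w : 0 < sqchord p q y ->
  derivable (dgen p q v) y w /\ 'D_w (dgen p q v) y = 'D_v (dgen p q w) y.
Proof.
move=> pq; have h u u' := is_deriveN (is_derive_hypot2 _ _ _ _ _ _ y u _ _ _ _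
  (is_derive_chord p q y u 0) (is_derive_chord p q y u 1)
  (is_derive_dchord p q y u' u 0) (is_derive_dchord p q y u' u 1) pq).
split; first by case: (h w v).
case: (h w v) => _ /= hwv; case: (h v w) => _ /= hvw.
rewrite -[LHS]/('D_w (- _) y) -[RHS]/('D_v (- _) y) {}hwv {}hvw.
rewrite [in LHS]ddchordC [in LHS](ddchordC _ _ _ _ _ 1).
rewrite !(mulrC (dchord p q w y _)) -[X in _ / _ - X / _]mulrC.
congr (- (_ / _ - _ / _)); rewrite [LHS]mulrC //.
Qed.

(** Nonvanishing of the chords is an open condition. The formula must hold on a neighbourhood
    because it is differentiated once more. *)
Lemma derive_L_near x v :
  (forall i, (i < N)%N -> gamma (x (inord i) 0) <> gamma (x (inord i.+1) 0)) ->
  \near x, \sum_(i < N) dgen (inord i) (inord i.+1) v x =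
           'D_v (L gamma (N:=N)) x.
Proof.
move=> xN.
have : \near x, forall i : 'I_N, 0 < sqchord (inord i) (inord i.+1) x.
  have F : Filter (nbhs x) by exact: nbhs_filter.
  apply: (@filter_forall _ 'I_N
    (fun i y => 0 < sqchord (inord i) (inord i.+1) y) _ F) => i.
  exact: (cvgr_gt _ (sqchord_continuous _ _ x))
    (sqchord_gt0 _ _ _ (xN i (ltn_ord i))).
apply: filterS => y yN.
have h := is_derive_sum (fun i => is_derive_gen _ _ _ v (yN i)).
have [_ <-] := h.
congr ('D_v _ y); apply/funext => z; rewrite fct_sumE; exact: eq_bigr.
Qed.

Lemma hess_sym x :
  (forall i, (i < N)%N -> gamma (x (inord i) 0) <> gamma (x (inord i.+1) 0)) ->
  (hess gamma x)^T = hess gamma x.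
Proof.
move=> xN; apply/matrixP => a b; rewrite !mxE.
have D (v w : 'cV[R]_N.+1) : 'D_w (fun y => 'D_v (L gamma (N:=N)) y) x =
    'D_w (fun y => \sum_(i < N) dgen (inord i) (inord i.+1) v y) x.
  by apply/esym/near_eq_derive; exact: derive_L_near.
rewrite [LHS]D [RHS]D.
have c (i : 'I_N) := sqchord_gt0 _ _ _ (xN i (ltn_ord i)).
have e (f : 'I_N -> 'cV[R]_N.+1 -> R) :
    (fun y => \sum_(i < N) f i y) = \sum_(i < N) f i.
  by apply/funext => y; rewrite fct_sumE.
rewrite !e !derive_sum; last 2 first.
- by move=> i; case: (derive_dgenC _ _ _ (delta_mx b 0) (delta_mx a 0) (c i)).
- by move=> i; case: (derive_dgenC _ _ _ (delta_mx a 0) (delta_mx b 0) (c i)).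
apply: eq_bigr => i _.
by case: (derive_dgenC _ _ _ (delta_mx a 0) (delta_mx b 0) (c i)).
Qed.

End Hessian.

(** * Index of a form and orthogonal projection *)

Section Index.
Variables (R : realType) (n : nat) (H : 'M[R]_n).
Implicit Types (u v w d e : 'cV[R]_n) (U V W : {vspace 'cV[R]_n}).
Local Notation B := (bform H).

Lemma bformDl u v w : B (u + v) w = B u w + B v w.
Proof. by rewrite /bform linearD /= !mulmxDl mxE. Qed.

Lemma bformZl a u w : B (a *: u) w = a * B u w.
Proof. by rewrite /bform linearZ /= -!scalemxAl mxE. Qed.

Lemma bformDr u v w : B w (u + v) = B w u + B w v.
Proof. by rewrite /bform mulmxDr mxE. Qed.

Lemma bformZr a u w : B w (a *: u) = a * B w u.
Proof. by rewrite /bform -scalemxAr mxE. Qed.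

Lemma bform0l w : B 0 w = 0.
Proof. by rewrite -[0](scale0r w) bformZl mul0r. Qed.

(** The subspace 0 is the witness when the maximum takes its default value 0, hence the assumption
    that [S] contains 0. *)
Lemma index_attained (S : set 'cV[R]_n) : S 0 ->
  exists W, [/\ [set` W] `<=` S, \dim W = Defs.index H S &
                negative_definite_on H W].
Proof.
move=> S0; rewrite /Defs.index; elim/big_rec: _ => [|d m /asboolP dP mP].
  exists 0%VS; split; last 1 first.
  - by move=> w; rewrite memv0 => ->.
  - by move=> w /=; rewrite memv0 => /eqP ->.
  - exact: dimv0.
by rewrite /maxn; case: ifP.
Qed.

Lemma index_ge (S : set 'cV[R]_n) W :
  [set` W] `<=` S -> negative_definite_on H W -> (\dim W <= Defs.index H S)%N.
Proof.
move=> WS Wneg.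
have Wn : (\dim W < n.+1)%N.
  by have := dimvS (subvf W); rewrite dimvf /dim /= muln1 ltnS.
apply: (bigop.bigmax_sup (Ordinal Wn)) => //.
by apply/asboolP; exists W.
Qed.

(* The map v |-> (B(v, b_i))_i for a basis (b_i) of W is injective on W, hence
   onto; orthogonality to W is solvable inside W. *)
Lemma negdef_project W e : negative_definite_on H W ->
  exists2 w, w \in W & forall u, u \in W -> B (e - w) u = 0.
Proof.
move=> Wneg; pose m := \dim W; pose b := vbasis W.
pose f0 v : 'cV[R]_m := \col_i B v b`_i.
have f0_lin : linear f0.
  by move=> a u v; apply/matrixP => i j; rewrite !mxE bformDl bformZl.
pose fL := GRing.isLinear.Build _ _ _ _ f0 f0_lin.
pose fl : {linear 'cV[R]_n -> 'cV[R]_m} := HB.pack f0 fL.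
pose f := linfun fl.
have perp v : f v = 0 -> forall u, u \in W -> B v u = 0.
  rewrite lfunE /= => fv u uW; rewrite (coord_vbasis uW).
  elim/big_rec: _ => [|i z _ zv].
    by rewrite -(scale0r v) bformZr mul0r.
  rewrite bformDr bformZr zv addr0.
  by have /matrixP/(_ i 0) := fv; rewrite !mxE => ->; rewrite mulr0.
(* A vector of [W] in the kernel is orthogonal to [W], hence to itself, so it is 0. *)
have WK : (W :&: lker f = 0)%VS.
  apply/eqP; rewrite -subv0; apply/subvP => w /memv_capP[wW].
  rewrite memv_ker memv0 => /eqP/perp/(_ _ wW) ww.
  by apply/negPn/negP => /(Wneg _ wW); rewrite ww ltxx.
have fW : (f @: W)%VS = fullv.
  by apply/eqP; rewrite eqEdim subvf/= dimvf /dim /= muln1 (limg_dim_eq WK).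
have /memv_imgP[w wW few] : f e \in (f @: W)%VS by rewrite fW memvf.
by exists w => // u uW; apply: perp => //; rewrite linearB /= few subrr.
Qed.

End Index.

(** * Index on a space and on the kernel of a linear form in it *)

Section Hyperplane.
Variables (R : realType) (n : nat) (H : 'M[R]_n).
Hypothesis Hsym : H^T = H.
Variables (V : {vspace 'cV[R]_n}) (f : 'Hom('cV[R]_n, R^o)).
Hypothesis Hnd : nondegenerate_on H [set` V].
Let V0 := (V :&: lker f)%VS.
Implicit Types (u v w d e : 'cV[R]_n) (W : {vspace 'cV[R]_n}).
Local Notation B := (bform H).

Lemma bformC u v : B u v = B v u.
Proof.
have -> : B u v = ((u^T *m H *m v)^T) 0 0 by rewrite [RHS]mxE.
by rewrite !trmx_mul trmxK Hsym mulmxA.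
Qed.

Lemma memV0 v : v \in V0 = (v \in V) && (f v == 0).
Proof. by rewrite memv_cap memv_ker. Qed.

Lemma shear_hyperplane e v : f e != 0 -> e \in V -> v \in V ->
  v - (f v / f e) *: e \in V0.
Proof.
move=> fe eV vV; rewrite memV0 rpredB ?rpredZ//= linearB linearZ /=.
by rewrite /GRing.scale /= divfK// subrr.
Qed.

Section Orthogonal.
Variable d : 'cV[R]_n.
Hypotheses (dV : d \in V) (dperp : forall v, v \in V0 -> B d v = 0).

(** Nondegeneracy gives [e] in [V] not orthogonal to [d]; it lies off [V0], to which [d] is
    orthogonal. *)
Lemma dual_vector : d != 0 -> exists e, [/\ e \in V, B d e != 0 & f e != 0].
Proof.
move=> d0; apply: contrapT => he; case/eqP: d0.
apply: Hnd => // w wV; apply/eqP/negPn/negP => dw.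
apply: he; exists w; split => //.
by apply: contra dw => fw; rewrite dperp// memV0 wV.
Qed.

(** The scalar makes [d' - c *: d] orthogonal to [e] as well as to [V0], and these span [V]. *)
Lemma orthogonal_hyperplane_unique d' : d != 0 -> d' \in V ->
  (forall v, v \in V0 -> B d' v = 0) -> exists c, d' = c *: d.
Proof.
move=> d0 d'V d'perp; have [e [eV de fe]] := dual_vector d0.
exists (B d' e / B d e); apply/eqP; rewrite -subr_eq0; apply/eqP.
set c := _ / _; have zE v : B (d' - c *: d) v = B d' v - c * B d v.
  by rewrite bformDl -scaleNr bformZl mulNr.
apply: Hnd => [/=|w wV]; first by rewrite rpredB ?rpredZ.
have -> : w = (w - (f w / f e) *: e) + (f w / f e) *: e by rewrite subrK.
have wV0 := shear_hyperplane _ _ fe eV wV.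
rewrite bformDr bformZr !zE dperp// d'perp// mulr0 subr0 add0r.
by rewrite /c divfK// subrr mulr0.
Qed.

Lemma index_hyperplane_le : (Defs.index H [set` V0] <= Defs.index H [set` V])%N.
Proof.
have [|W [WV0 <- Wneg]] := @index_attained _ _ H [set` V0]; first exact: mem0v.
by apply: index_ge => // w /WV0/=; rewrite memV0 => /andP[].
Qed.

(** A subspace loses at most one dimension when cut by the kernel of one linear form. *)
Lemma index_le_hyperplaneS :
  (Defs.index H [set` V] <= (Defs.index H [set` V0]).+1)%N.
Proof.
have [|W [WV <- Wneg]] := @index_attained _ _ H [set` V]; first exact: mem0v.
have WV0 : [set` (W :&: lker f)%VS] `<=` [set` V0].
  by move=> w /=; rewrite memV0 memv_cap memv_ker => /andP[/WV/= -> ->].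
have Wneg' : negative_definite_on H (W :&: lker f)%VS.
  by move=> w /memv_capP[wW _]; exact: Wneg.
rewrite -(limg_ker_dim f W) -[leqRHS]addn1 leq_add//; first exact: index_ge.
by rewrite (leq_trans (dimvS (subvf _)))// dimvf.
Qed.

(** The shear [g] along [d] sends [V] into [V0]. As [d] is orthogonal to [V0], [B w w] exceeds
    [B (g w) (g w)] by a nonnegative multiple of [B d d]. *)
Lemma index_hyperplane_pos :
  0 < B d d -> Defs.index H [set` V] = Defs.index H [set` V0].
Proof.
move=> dd; apply/eqP; rewrite eqn_leq index_hyperplane_le andbT.
(* Otherwise [d] would lie in [V0] and be orthogonal to itself. *)
have fd : f d != 0.
  by apply: contraL dd => fd; rewrite dperp ?ltxx// memV0 dV.
have [|W [WV <- Wneg]] := @index_attained _ _ H [set` V]; first exact: mem0v.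
pose g0 v : 'cV[R]_n := v - (f v / f d) *: d.
have g0_lin : linear g0.
  move=> a u v; rewrite /g0 linearP /= mulrDl scalerDl scalerBr scalerA.
  by rewrite /GRing.scale /= mulrA opprD addrACA.
pose gL := GRing.isLinear.Build _ _ _ _ g0 g0_lin.
pose gl : {linear 'cV[R]_n -> 'cV[R]_n} := HB.pack g0 gL.
pose g := linfun gl.
have gE v : g v = v - (f v / f d) *: d by rewrite lfunE.
have BgE w : w \in V -> B w w = B (g w) (g w) + (f w / f d) ^+ 2 * B d d.
  move=> wV; have gV0 := shear_hyperplane _ _ fd dV wV; rewrite -gE in gV0.
  rewrite -{1 2}[w](subrK ((f w / f d) *: d)) -gE.
  rewrite !(bformDl, bformDr, bformZl, bformZr) (bformC _ d) dperp//; ring.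
have dd_ge0 (a : R) : 0 <= a ^+ 2 * B d d by rewrite mulr_ge0 ?sqr_ge0 ?ltW.
have gneg w : w \in W -> w != 0 -> B (g w) (g w) < 0.
  move=> wW w0; have := Wneg _ wW w0; rewrite BgE; last exact: WV.
  by apply: le_lt_trans; rewrite lerDl.
rewrite -(limg_dim_eq (_ : (W :&: lker g = 0)%VS)); last first.
  apply/eqP; rewrite -subv0; apply/subvP => w /memv_capP[wW].
  rewrite memv_ker memv0 => /eqP gw; apply/negPn/negP => /(gneg _ wW).
  by rewrite gw bform0l ltxx.
apply: index_ge => [_ /memv_imgP[w wW ->]|_ /memv_imgP[w wW ->] gw].
  by rewrite /= gE; apply: shear_hyperplane => //; exact: WV.
by apply: gneg => //; apply: contra_neq gw => ->; rewrite linear0.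
Qed.

(** Common end of both nonpositive cases: [e + w] is negative, orthogonal to [W] and off [V0], so it
    extends a largest negative definite [W] in [V0] by one dimension. *)
Lemma index_hyperplane_add e : e \in V -> f e != 0 ->
  (forall W, [set` W] `<=` [set` V0] -> negative_definite_on H W ->
     exists w, [/\ w \in V0, B (e + w) (e + w) < 0 &
       forall u, u \in W -> B (e + w) u = 0]) ->
  Defs.index H [set` V] = (Defs.index H [set` V0]).+1.
Proof.
move=> eV fe eW; apply/eqP; rewrite eqn_leq index_le_hyperplaneS/=.
have [|W [WV0 WE Wneg]] := @index_attained _ _ H [set` V0]; first exact: mem0v.
have [w [wV0 ww wperp]] := eW W WV0 Wneg.
have fv : f (e + w) != 0.
  by move: wV0; rewrite memV0 => /andP[_ /eqP fw]; rewrite linearD /= fw addr0.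
have vV : e + w \in V by move: wV0; rewrite memV0 => /andP[wV _]; exact: rpredD.
move: (e + w) ww wperp fv vV => v ww wperp fv vV.
have v0 : v != 0 by apply: contraNneq fv => ->; rewrite linear0.
have Wv : (W :&: <[v]> = 0)%VS.
  apply/eqP; rewrite -subv0; apply/subvP => _ /memv_capP[/[swap]/vlineP[k ->]].
  move=> /WV0 /=; rewrite memV0 linearZ /= scaler_eq0 (negPf fv) orbF.
  by case/andP => _ /eqP ->; rewrite scale0r mem0v.
have := dimv_disjoint_sum Wv; rewrite WE dim_vline v0 addn1 => <-.
apply: index_ge.
  move=> _ /memv_addP[u /WV0 /= + [_ /vlineP[k ->] ->]].
  by rewrite memV0 => /andP[uV _]; rewrite rpredD ?rpredZ.
move=> _ /memv_addP[u uW [_ /vlineP[k ->] ->]].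
rewrite !(bformDl, bformDr, bformZl, bformZr) (bformC u) wperp//.
rewrite !mulr0 addr0 add0r => kv.
have kk : k * (k * B v v) = k ^+ 2 * B v v by rewrite mulrA expr2.
(* If [u] is 0, strictness comes from the [k] term, otherwise from [u]. *)
rewrite kk; have [u0|u0] := eqVneq u 0.
  rewrite u0 bform0l add0r pmulr_rlt0// exprn_even_gt0//=.
  by apply: contraNneq kv => ->; rewrite u0 scale0r addr0.
by rewrite ltr_wnDr ?Wneg// mulr_ge0_le0 ?sqr_ge0 ?ltW.
Qed.

Lemma index_hyperplane_nonpos : d != 0 -> B d d <= 0 ->
  Defs.index H [set` V] = (Defs.index H [set` V0]).+1.
Proof.
move=> d0; have [e [eV de fe]] := dual_vector d0.
rewrite le_eqVlt => /orP[/eqP dd|dd].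
  (* If [f d] were nonzero, [e] would be a vector of [V0] plus a multiple of [d], both orthogonal to
     [d]. *)
  have fd : f d == 0.
    apply: contraNT de => fd; rewrite -[e](subrK ((f e / f d) *: d)) bformDr.
    by rewrite bformZr dd mulr0 addr0 dperp// shear_hyperplane.
  have dV0 : d \in V0 by rewrite memV0 dV.
  apply: (@index_hyperplane_add e) => // W WV0 Wneg.
  have [w wW] := negdef_project _ _ H W e Wneg.
  have wV0 : w \in V0 by exact: WV0.
  have dw : B d (e - w) = B d e.
    by rewrite bformDr -scaleN1r bformZr (dperp w)// mulr0 addr0.
  (* With [z = e - w], isotropy of [d] gives [B (z + t *: d) (z + t *: d) = B z z + 2 * t * B d e];
     this [t] makes it -1. *)
  move=> zperp; pose t := (- 1 - B (e - w) (e - w)) / (B d e *+ 2).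
  have eE : e + (t *: d - w) = (e - w) + t *: d by rewrite addrCA addrC.
  exists (t *: d - w); rewrite eE.
  move: (e - w) dw zperp @t {eE} => z dw zperp t; split.
  - by rewrite rpredB ?rpredZ.
  - rewrite !(bformDl, bformDr, bformZl, bformZr) (bformC z) dd dw /t.
    (* Here [a] is [B z z], [b] is [B d e], and the final factor 0 is [B d d]. *)
    suff -> : forall a b : R, b != 0 ->
      a + (- 1 - a) / (b *+ 2) * b + ((- 1 - a) / (b *+ 2) * b
      + (- 1 - a) / (b *+ 2) * ((- 1 - a) / (b *+ 2) * 0)) = - 1 by [].
    by move=> a b b0; field; rewrite b0.
  - move=> u uW; rewrite bformDl zperp// bformZl dperp; last exact: WV0.
    by rewrite mulr0 addr0.
(* Now [B d d < 0], so [d] lies off [V0] and, being orthogonal to it, extends any [W] without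
   correction. *)
have fd : f d != 0.
  by apply: contraTneq dd => fd; rewrite dperp ?ltxx// memV0 dV fd eqxx.
apply: (@index_hyperplane_add d) => // W WV0 _; exists 0; split.
- exact: mem0v.
- by rewrite addr0.
- by move=> u uW; rewrite addr0 dperp//; exact: WV0.
Qed.

End Orthogonal.
End Hyperplane.

(** * Periodic Jacobi variations and the concavity formula *)

(* N equations in N + 1 unknowns: the row of index ord_max of M is zero. *)
Lemma exists_periodic_jacobi (R : realType) (N : nat) (H : 'M[R]_N.+1) :
  (0 < N)%N ->
  exists d : 'cV[R]_N.+1,
    [/\ d != 0, periodic_variations d & jacobi_variation H d].
Proof.
(* Row [ord0] expresses periodicity, the inner rows the Jacobi equations; the zero row makes [M]
   singular. *)
move=> N0; pose M : 'M[R]_N.+1 := \matrix_(i, j)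
  if i == ord_max then 0
  else if i == ord0 then (j == ord0)%:R - (j == ord_max)%:R
  else H i j.
have /eqP/det0P[v v0 vM] : \det M^T = 0.
  rewrite det_tr (expand_det_row _ ord_max) big1// => j _.
  by rewrite mxE eqxx mul0r.
have Mv : M *m v^T = 0 by rewrite -[M]trmxK -trmx_mul vM trmx0.
have Mi i : (M *m v^T) i 0 = 0 by rewrite Mv mxE.
(* The end indices differ, so the zero row does not overwrite the periodicity row. *)
have o : (ord0 == ord_max :> 'I_N.+1) = false.
  by apply/eqP => /(congr1 val) /= N0'; rewrite -N0' in N0.
exists v^T; split.
- by apply: contra_neq v0 => /(congr1 trmx); rewrite trmxK trmx0.
- apply/eqP; rewrite -subr_eq0; apply/eqP; rewrite -[RHS](Mi ord0) [RHS]mxE.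
  have s k : \sum_j (j == k)%:R * v^T j 0 = v^T k 0.
    rewrite (bigD1 k)//= eqxx mul1r big1 ?addr0// => j /negPf ->.
    by rewrite mul0r.
  under [RHS]eq_bigr do rewrite mxE o eqxx mulrBl.
  by rewrite sumrB !s.
- move=> i i0 im; rewrite -[RHS](Mi i) !mxE.
  by apply: eq_bigr => j _; rewrite [M i j]mxE (negPf i0) (negPf im).
Qed.

(** [H *m d] is supported on the two end entries, where [v] vanishes. *)
Lemma jacobi_perp_fixed (R : realType) (N : nat) (H : 'M[R]_N.+1) d v :
  H^T = H -> jacobi_variation H d -> fixed_variations v -> bform H d v = 0.
Proof.
move=> Hsym dJ [v0 vN]; rewrite bformC// /bform -mulmxA mxE big1// => i _.
rewrite mxE; have [->|i0] := eqVneq i ord0; first by rewrite v0 mul0r.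
have [->|iN] := eqVneq i ord_max; first by rewrite vN mul0r.
by rewrite dJ// mulr0.
Qed.

Lemma jacobi_endpoint_col (R : realType) (N : nat) (H : 'M[R]_N.+1) d :
  jacobi_variation H d ->
  H *m d = endpoint_col N ((H *m d) ord0 0) ((H *m d) ord_max 0).
Proof.
move=> dJ; apply/matrixP => i j; rewrite (ord1 j) [RHS]mxE.
case: eqVneq => [->//|i0]; case: eqVneq => [->//|iN]; exact: dJ.
Qed.

Theorem proposition2p10 (R : realType) (T : R) (gamma : R -> 'cV[R]_2)
    (N : nat) (x : 'cV[R]_N.+1) :
  (2 <= N)%N ->
  convex_billiard T gamma ->
  periodic_trajectory T gamma x ->
  let H := hess gamma x in
  nondegenerate_on H periodic_variations ->
  let nonzero_periodic_jacobi (dx : 'cV[R]_N.+1) : Prop :=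
    [/\ dx != 0, periodic_variations dx & jacobi_variation H dx] in
  [/\ exists dx : 'cV[R]_N.+1,
        [/\ nonzero_periodic_jacobi dx,
            exists c1 c2 : R, H *m dx = endpoint_col N c1 c2 &
            forall dy : 'cV[R]_N.+1, nonzero_periodic_jacobi dy ->
              exists2 c : R, c != 0 & dy = c *: dx] &
      forall dx : 'cV[R]_N.+1, nonzero_periodic_jacobi dx ->
        concavity H = (if bform H dx dx <= 0 then 1 else 0)].
Proof.
move=> N2 [[_ simple gamma1 gamma2 _ _ _] _] [adm _ _ _] H Hnd P.
have Hsym : H^T = H.
  (* By injectivity of the curve on the circle, distinct consecutive points have distinct images. *)
  apply: hess_sym => // i iN /simple; by have [] := adm i iN.
pose c0 (i : 'I_N.+1) (v : 'cV[R]_N.+1) : R^o := v i 0.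
have c0_lin i : linear (c0 i) by move=> a u v; rewrite /c0 !mxE.
pose cl i : {linear 'cV[R]_N.+1 -> R^o} :=
  HB.pack (c0 i) (GRing.isLinear.Build _ _ _ _ _ (c0_lin i)).
pose f i := linfun (cl i).
have fE i v : f i v = v i 0 by rewrite lfunE.
(* The periodic variations as the kernel of a linear form. Inside it, vanishing of [f ord0] forces
   both end entries to vanish. *)
pose V := lker (f ord0 - f ord_max).
have VE v : (v \in V) = (v ord0 0 == v ord_max 0).
  by rewrite memv_ker add_lfunE opp_lfunE !fE subr_eq0.
have perE : periodic_variations = [set` V].
  by apply/seteqP; split => v /=; rewrite VE => /eqP.
have fixE : fixed_variations = [set` (V :&: lker (f ord0))%VS].
  apply/seteqP; split => v /=; rewrite memV0 VE fE.
    by move=> [-> ->]; rewrite eqxx.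
  by move=> /andP[/eqP v0N /eqP v0]; split; rewrite -?v0N.
have HndV : nondegenerate_on H [set` V] by rewrite -perE.
have PV d : P d -> d \in V by case=> _ dV _; rewrite VE; exact/eqP.
have Pperp d : P d ->
    forall v, v \in (V :&: lker (f ord0))%VS -> bform H d v = 0.
  move=> [_ _ dJ] v vV0; apply: jacobi_perp_fixed => //.
  by rewrite fixE.
split.
  have [d Pd] := @exists_periodic_jacobi R N H (ltnW N2).
  exists d; split => // [|dy Pdy].
    by case: Pd => _ _ /jacobi_endpoint_col; do 2!eexists; eassumption.
  have [d0 _ _] := Pd; have [c dyE] := orthogonal_hyperplane_unique
    _ _ _ _ _ HndV _ (PV d Pd) (Pperp d Pd) dy d0 (PV dy Pdy) (Pperp dy Pdy).
  exists c => //; have [dy0 _ _] := Pdy.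
  by apply: contra_neq dy0 => c0E; rewrite dyE c0E scale0r.
move=> d Pd; have [d0 _ _] := Pd; rewrite /concavity perE fixE.
case: ifPn => [dd|].
  rewrite (index_hyperplane_nonpos _ _ _ Hsym _ _ HndV _ (PV d Pd) (Pperp d Pd)
    d0 dd).
  by rewrite -addn1 PoszD addrAC subrr add0r.
rewrite -ltNge => dd.
rewrite (index_hyperplane_pos _ _ _ Hsym _ _ _ (PV d Pd) (Pperp d Pd) dd).
exact: subrr.
Qed.
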